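(* For all integers $\ell, d \geq 1$, $$f^{d}(\ell) = \Theta^{d}(\ell).$$
   Context: For an integer $\ell \geq 1$, an $\ell$-uniform hypergraph ($\ell$-graph) $H=(V,E)$ consists of a finite vertex set $V$ and a family $E\subseteq \binom{V}{\ell}$ of $\ell$-element subsets of $V$, called edges. A fractional matching in $H$ is a function $w : E \to [0,1]$ such that $\sum_{e \ni v} w(e) \leq 1$ for every $v \in V$; its size is $\sum_{e \in E} w(e)$. For integers $\ell, m\ge 1$ and a real number $0 \leq s \leq m/\ell$, $f_0^{s}(\ell,m)$ denotes the smallest integer $M$ such that every $\ell$-graph $H$ on $m$ vertices with at least $M$ edges (i.e. with minimum $0$-degree at least $M$, the $0$-degree being the total number of edges) has a fractional matching of size $s$. For integers $\ell, d \geq 1$, define $$f^{d}(\ell) := \limsup_{m \to \infty} \frac{f_0^{(m+d)/(\ell+d)}(\ell,m)}{\binom{m}{\ell}}$$ (note that $(m+d)/(\ell+d)\le m/\ell$ whenever $m\ge \ell$). For an integer $\ell\ge 1$ and $d > 0$, define $$\Theta^{d}(\ell) := \sup \Pr[X_1 + \dots + X_\ell \geq \ell + d],$$ where the supremum is over all collections of non-negative i.i.d. random variables $X_1,\dots,X_\ell$ with mean $1$. *)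

(* Defs.v *)
From mathcomp Require Import all_boot all_order all_algebra.
From mathcomp Require Import all_classical all_reals all_analysis.

Set Implicit Arguments.
Unset Strict Implicit.
Unset Printing Implicit Defensive.

Import Order.TTheory GRing.Theory Num.Theory.

Local Open Scope classical_set_scope.
Local Open Scope ring_scope.

Section FractionalMatchings.
Variable R : realType.

Definition uniform_hypergraph (l : nat) (V : finType) (E : {set {set V}}) : Prop :=
  forall e : {set V}, e \in E -> #|e| = l.

(* The values of [w] outside [E] are irrelevant. *)
Definition fractional_matching (V : finType) (E : {set {set V}})
    (w : {set V} -> R) : Prop :=
  (forall e : {set V}, e \in E -> 0 <= w e <= 1) /\
  (forall v : V, \sum_(e in E | v \in e) w e <= 1).

Definition matching_size (V : finType) (E : {set {set V}})
    (w : {set V} -> R) : R :=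
  \sum_(e in E) w e.

Definition has_fractional_matching (V : finType) (E : {set {set V}}) (s : R) : Prop :=
  exists w : {set V} -> R, fractional_matching E w /\ matching_size E w = s.

Definition edges_force_matching (s : R) (l m M : nat) : Prop :=
  forall (V : finType) (E : {set {set V}}),
    #|V| = m -> uniform_hypergraph l E -> (M <= #|E|)%N ->
    has_fractional_matching E s.

(* The bound 'C(m, l) + 1 works vacuously, so the minimum below exists even
   for [s] outside the range 0 <= s <= m / l. *)
Lemma edges_force_matching_ex (s : R) (l m : nat) :
  exists M : nat, `[< edges_force_matching s l m M >].
Proof.
exists 'C(m, l).+1; apply/asboolP => V E cardV unifE leE; exfalso.
have sub : (E \subset [set e : {set V} | #|e| == l])%SET.
  by apply/fintype.subsetP => e /unifE el; rewrite inE el.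
by move: (subset_leq_card sub); rewrite card_draws cardV leqNgt leE.
Qed.

Definition f0 (s : R) (l m : nat) : nat := ex_minn (edges_force_matching_ex s l m).

(* The limit superior is taken in the extended reals.  The finitely many terms
   with m < l, where the quotient is a division by zero, do not affect it. *)
Definition f_limsup (l d : nat) : \bar R :=
  limn_esup (fun m : nat =>
    ((f0 ((m + d)%N%:R / (l + d)%N%:R) l m)%:R / 'C(m, l)%:R)%:E).

End FractionalMatchings.

Section IIDTail.
Variable R : realType.
Context {disp : measure_display} {T : measurableType disp}.
Variables (P : probability T R) (l : nat) (X : 'I_l -> {RV P >-> R}).

Definition mutually_independent : Prop :=
  forall (J : {set 'I_l}) (A : 'I_l -> set R),
    (forall i, measurable (A i)) ->
    P (\bigcap_(i in [set` J]) (X i @^-1` A i)) =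
    (\prod_(i in J) P (X i @^-1` A i))%E.

Definition identically_distributed : Prop :=
  forall (i j : 'I_l) (A : set R), measurable A ->
    distribution P (X i) A = distribution P (X j) A.

Definition nonneg_iid_mean1 : Prop :=
  [/\ forall i w, 0 <= X i w, mutually_independent, identically_distributed
    & forall i, ('E_P[X i] = 1)%E].

End IIDTail.

Definition Theta (R : realType) (l : nat) (d : R) : \bar R :=
  ereal_sup [set p : \bar R |
    exists (disp : measure_display) (T : measurableType disp)
           (P : probability T R) (X : 'I_l -> {RV P >-> R}),
      nonneg_iid_mean1 X /\
      p = P [set w : T | l%:R + d <= \sum_(i < l) X i w]].

(* Main.v *)
Require Import Defs.
From HB Require Import structures.
From mathcomp Require Import all_boot all_order all_algebra.
From mathcomp Require Import all_classical all_reals all_analysis.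
From mathcomp Require Import measurable_realfun.
From mathcomp Require Import zify ring lra.

(** By linear programming duality, an l-graph on m vertices without a fractional
    matching of size s = (m + d) / (l + d) is covered by vertex weights y >= 0 of
    total < s such that every edge has weight at least 1.  So f0 - 1 is the largest
    number of l-sets of weight at least 1 ("good" l-sets) for a weighting of total
    < s, and the matter is to compare an l-set of vertices with an i.i.d. sample.

    From weights to variables: add d vertices of weight 0 and sample l of the m + d
    vertices independently and uniformly.  The variables (l + d) y have mean less
    than 1, and every ordering of a good l-set gives a sum >= l + d.

    From variables to weights: put the quantiles q(1/m), ..., q((m-1)/m) of X,
    divided by l + d, on m - 1 vertices, and 0 on the last one.  The q(j/m) sum to
    at most m because the j-th one is below q on the next block of length 1/m.
    Conversely X is stochastically dominated by a uniformly chosen quantile, once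
    the last vertex counts as infinite, so P(X_1 + ... + X_l >= l + d) is at most
    the proportion of good l-tuples, up to the tuples that repeat a vertex or use
    the last one.  These are negligible as m grows. *)

Set Implicit Arguments.
Unset Strict Implicit.
Unset Printing Implicit Defensive.

Import Order.TTheory GRing.Theory Num.Theory.
Import numFieldNormedType.Exports.

Local Open Scope ring_scope.

(** * Linear programming duality *)

(* Bartl's induction on the number of functionals. *)
Lemma farkas (R : realFieldType) (W : lmodType R) (I : eqType) (s : seq I)
    (a : I -> W -> R) (g : W -> R) :
  uniq s -> (forall i, scalar (a i)) -> scalar g ->
  (forall x, (forall i, i \in s -> 0 <= a i x) -> 0 <= g x) ->
  exists c : I -> R, (forall i, 0 <= c i) /\
    forall x, g x = \sum_(i <- s) c i * a i x.
Proof.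
elim: s a g => [|k s IH] a g /=.
  move=> _ _ lg g0; exists (fun=> 0); split=> // x.
  have g_ge0 y : 0 <= g y by apply: g0.
  rewrite big_nil; apply/eqP; rewrite eq_le g_ge0 andbT.
  have := lg (-2%:R) x x.
  by move: (g_ge0 x) (g_ge0 (- 2%:R *: x + x)) => /= ? ? ?; lra.
case/andP=> ks us la lg hg.
(* If the functionals in [s] already force [g] to be nonnegative, [k] gets coefficient 0. *)
case: (pselect (forall x, (forall i, i \in s -> 0 <= a i x) -> 0 <= g x)).
  move=> h; have [c [c0 cE]] := IH a g us la lg h.
  exists (fun i => if i == k then 0 else c i); split=> [i|x].
    by case: ifP.
  rewrite big_cons eqxx mul0r add0r cE.
  rewrite [in LHS]big_seq [in RHS]big_seq; apply: eq_bigr => i si.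
  by case: eqP => // ik; rewrite -ik si in ks.
(* Otherwise some [z] violates the implication, and then [a k z < 0]. Moving [x] along [z] until
   [a k] vanishes turns [a i] and [g] into [a'] and [g'], to which the induction hypothesis
   applies. *)
move=> /existsNP[z /not_implyP[az /negP]]; rewrite -ltNge => gz.
have akz : a k z < 0.
  rewrite ltNge; apply/negP => akz; move: gz; rewrite ltNge hg// => i.
  by rewrite inE => /predU1P[->//|/az].
pose t := - (a k z).
have t0 : 0 < t by rewrite oppr_gt0.
pose a' i x := a i x + a i z / t * a k x.
pose g' x := g x + g z / t * a k x.
have sc (f : W -> R) : scalar f -> forall b, scalar (fun x => f x + b * a k x).
  by move=> lf b r x y; rewrite lf la /=; ring.
have [|c [c0 cE]] := IH a' g' us (fun i => sc _ (la i) _) (sc _ lg _).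
  move=> x hx; have := hg ((a k x / t) *: z + x).
  rewrite lg /= /g' => h.
  have -> : g x + g z / t * a k x = a k x / t * g z + g x by ring.
  apply: h => i; rewrite inE la /= => /predU1P[->|si].
    have -> : a k x / t * a k z = - a k x.
      by rewrite -[a k z]opprK -/t; field; lra.
    by rewrite addNr.
  have -> : a k x / t * a i z + a i x = a i x + a i z / t * a k x by ring.
  exact: hx i si.
(* Undoing the projection collects all multiples of [a k] in one coefficient, nonnegative because
   [g z < 0]. *)
exists (fun i => if i == k then - g z / t + \sum_(j <- s) c j * (a j z / t) else c i).
split=> [i|x].
  case: eqP => // _; apply: addr_ge0.
    by rewrite divr_ge0// ?ltW// oppr_gt0.
  rewrite big_seq; apply: sumr_ge0 => j js; apply: mulr_ge0 => //.
  by apply: divr_ge0; [exact: az|exact: ltW].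
rewrite big_cons eqxx.
have -> : g x = g' x - g z / t * a k x by rewrite /g' addrK.
rewrite cE mulrDl mulr_suml.
transitivity (\sum_(i <- s) c i * a i x +
    \sum_(i <- s) c i * (a i z / t) * a k x - g z / t * a k x).
  by rewrite -big_split/=; congr (_ - _); apply: eq_bigr => i _; rewrite /a'; ring.
have -> : \sum_(j <- s)
      (if j == k then - g z / t + \sum_(j0 <- s) c j0 * (a j0 z / t) else c j) * a j x =
    \sum_(j <- s) c j * a j x.
  rewrite [in LHS]big_seq [in RHS]big_seq; apply: eq_bigr => i si.
  by case: eqP => // ik; rewrite -ik si in ks.
by ring.
Qed.

Section Duality.
Variables (R : realType) (V : finType) (E : {set {set V}}) (s : R).

(** Weak duality: the products [w e * y v] over incident pairs are summed in both orders. *)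
Lemma no_matching_of_cover (y : V -> R) :
  (forall v, 0 <= y v) -> \sum_v y v < s ->
  (forall e, e \in E -> 1 <= \sum_(v in e) y v) ->
  ~ has_fractional_matching E s.
Proof.
move=> y0 ys ye [w [[w01 wv] ws]].
move: ys; apply/negP; rewrite -leNgt -ws /matching_size.
apply: (@le_trans _ _ (\sum_(e in E) \sum_(v in e) w e * y v)).
  apply: ler_sum => e eE; rewrite -mulr_sumr ler_peMr ?ye//.
  by have /andP[] := w01 e eE.
rewrite (exchange_big_dep xpredT)//=; apply: ler_sum => v _.
rewrite -mulr_suml ler_piMl//.
Qed.

(** Strong duality from Farkas' lemma for the homogenized program: [x] is a weighting [x.1] with a
    scale [x.2], and each edge must weigh at least the scale. Without a cover of total below [s],
    these constraints force [g >= 0], and the multipliers of the edge constraints form a matching of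
    size [s]. *)
Lemma cover_of_no_matching :
  0 <= s -> (forall e, e \in E -> e != finset.set0) ->
  ~ has_fractional_matching E s ->
  exists y : V -> R, [/\ forall v, 0 <= y v, \sum_v y v < s &
    forall e, e \in E -> 1 <= \sum_(v in e) y v].
Proof.
move=> s0 E0 nm; apply: contrapT => ny; apply: nm.
pose W : lmodType R := ({ffun V -> R^o} * R^o)%type.
pose J : finType := (V + {set V})%type.
pose a (j : J) (x : W) : R := match j with
  | inl v => x.1 v | inr e => \sum_(v in e) x.1 v - x.2 end.
pose g (x : W) : R := \sum_v x.1 v - s * x.2.
pose r := [seq j <- enum J | match j with inl _ => true | inr e => e \in E end].
have ur : uniq r by rewrite filter_uniq ?enum_uniq.
have la j : scalar (a j).
  case: j => [v|e] b x y /=; first by rewrite !ffunE.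
  rewrite mulrBr mulr_sumr -[LHS]/(_ - (b * x.2 + y.2)).
  under eq_bigr do rewrite !ffunE.
  by rewrite big_split/=; under [X in X + _ - _]eq_bigr do rewrite -[_ *: _]/(_ * _); ring.
have lg : scalar g.
  move=> b x y; rewrite /g mulrBr mulr_sumr -[(b *: x + y).2]/(b * x.2 + y.2).
  under eq_bigr do rewrite !ffunE.
  by rewrite big_split/=; under [X in X + _ - _]eq_bigr do rewrite -[_ *: _]/(_ * _); ring.
have [|c [c0 cE]] := farkas ur la lg.
  move=> x hx.
  have x0 v : 0 <= x.1 v by apply: (hx (inl v)); rewrite mem_filter mem_enum.
  have xe e : e \in E -> x.2 <= \sum_(v in e) x.1 v.
    move=> eE; rewrite -subr_ge0; apply: (hx (inr e)).
    by rewrite mem_filter mem_enum eE.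
  (* A nonpositive scale makes the claim trivial; a positive one is divided out and would give an
     excluded cover. *)
  rewrite /g subr_ge0; have [x2|x2] := leP x.2 0.
    by apply: (@le_trans _ _ 0); [exact: mulr_ge0_le0|exact: sumr_ge0].
  rewrite leNgt; apply/negP => lts; apply: ny.
  exists (fun v => x.1 v / x.2); split.
  - by move=> v; rewrite divr_ge0// ltW.
  - by rewrite -mulr_suml ltr_pdivrMr.
  - by move=> e eE; rewrite -mulr_suml ler_pdivlMr// mul1r xe.
exists (fun e => c (inr e)).
have cE' x : g x = \sum_v c (inl v) * x.1 v +
    \sum_(e in E) c (inr e) * (\sum_(v in e) x.1 v - x.2).
  rewrite cE big_filter big_enum_cond/= big_sumType/=.
  by congr (_ + _); apply: eq_bigl => //= e.
have wv v : \sum_(e in E | v \in e) c (inr e) <= 1.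
  (* Testing the identity on the indicator of [v] at scale 0 reads off the load at [v], with slack
     [c (inl v)]. *)
  have := cE' ([ffun u => (u == v)%:R], 0); rewrite /g /= mulr0 subr0.
  have sv (A : {set V}) :
      \sum_(i in A) ([ffun u : V => (u == v)%:R] : {ffun V -> R^o}) i = (v \in A)%:R.
    under eq_bigr do rewrite ffunE.
    have [vA|vA] := boolP (v \in A).
      by rewrite (bigD1 v)//= eqxx big1 ?addr0// => u /andP[_ /negbTE->].
    by rewrite big1// => u uA; case: eqP => // uv; rewrite -uv uA in vA.
  have -> : \sum_v0 ([ffun u : V => (u == v)%:R] : {ffun V -> R^o}) v0 = 1.
    have := sv [set: V]%SET; under eq_bigl do rewrite finset.in_setT.
    by rewrite finset.in_setT.
  move=> ->; rewrite (bigD1 v)//= ffunE eqxx mulr1 [X in _ + X + _]big1 => [|u uv]; last first.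
    by rewrite /= ffunE (negbTE uv) mulr0.
  rewrite addr0; under [X in _ <= _ + X]eq_bigr do rewrite /= sv subr0.
  rewrite big_mkcondr/=.
  rewrite -[leLHS]add0r lerD// le_eqVlt; apply/orP; left; apply/eqP.
  by apply: eq_bigr => e _; case: ifP; rewrite ?mulr1 ?mulr0.
split; first split=> //.
(* The bound by 1 comes from the load at any vertex of the nonempty edge. *)
- move=> e eE; rewrite c0/=; have /set0Pn[v ve] := E0 e eE.
  apply: le_trans (wv v); rewrite (bigD1 e) ?eE//= lerDl.
  by apply: sumr_ge0.
(* Zero weights at scale -1 isolate the total of the edge multipliers. *)
- rewrite /matching_size; have := cE' (0, -1); rewrite /g /=.
  rewrite big1 => [|v _]; last by rewrite /= ffunE.
  rewrite sub0r mulrN1 opprK => ->.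
  rewrite [X in _ = X + _]big1 => [|v _]; last by rewrite /= ffunE mulr0.
  rewrite add0r; apply: eq_bigr => e _.
  by rewrite big1 ?sub0r ?opprK ?mulr1// => v _; rewrite /= ffunE.
Qed.

End Duality.

(** * Orderings of edges *)

Lemma card_inj_image (l : nat) (V : finType) (E : {set {set V}}) :
  uniform_hypergraph l E ->
  #|[set f : {ffun 'I_l -> V} | injectiveb f & (f @: [set: 'I_l])%SET \in E]%SET| =
    (l`! * #|E|)%N.
Proof.
move=> uE; rewrite -sum1_card.
rewrite (partition_big (fun f : {ffun 'I_l -> V} => f @: [set: 'I_l])%SET (mem E))/=;
  last first.
  by move=> f; rewrite inE => /andP[].
rewrite -sum1_card big_distrr/=; apply: eq_bigr => e eE; rewrite muln1.
(* The fibre over [e] consists of the l! injections into [e], which are onto because [e] has [l]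
   elements. *)
have := card_inj_ffuns_on 'I_l (mem e).
rewrite (uE _ eE) card_ord ffactnn => <-; rewrite -sum1_card; apply: eq_bigl => f.
rewrite !inE; apply/andP/andP => [[/andP[fi _] /eqP <-]|[fe fi]].
  by split=> //; apply/fintype.forallP => i; apply: imset_f; rewrite finset.in_setT.
have fE : (f @: [set: 'I_l])%SET = e.
  apply/eqP; rewrite eqEcard; apply/andP; split.
    by apply/fintype.subsetP => _ /imsetP[i _ ->]; apply: (ffun_onP fe).
  by rewrite card_imset ?cardsT ?card_ord ?(uE _ eE)//; apply/injectiveP.
by rewrite fE eqxx eE fi.
Qed.

Lemma sum_inj_image (R : nmodType) (l : nat) (V : finType) (y : V -> R)
    (f : {ffun 'I_l -> V}) :
  injectiveb f -> \sum_(v in (f @: [set: 'I_l])%SET) y v = \sum_i y (f i).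
Proof.
move=> /injectiveP fi; rewrite big_imset/=; last by move=> i j _ _ /fi.
by apply: eq_bigl => i; rewrite finset.in_setT.
Qed.

(** * Covers and the extremal number *)

Section F0.
Variables (R : realType).
Implicit Type s : R.

Lemma f0P s l m : edges_force_matching s l m (f0 s l m).
Proof. by rewrite /f0; case: ex_minnP => n /asboolP. Qed.

Lemma f0_min s l m n : edges_force_matching s l m n -> (f0 s l m <= n)%N.
Proof. by move=> h; rewrite /f0; case: ex_minnP => k _ /(_ n); apply; apply/asboolP. Qed.

Lemma lt_f0_of_cover s (l : nat) (V : finType) (E : {set {set V}}) (y : V -> R) :
  uniform_hypergraph l E -> (forall v, 0 <= y v) -> \sum_v y v < s ->
  (forall e, e \in E -> 1 <= \sum_(v in e) y v) -> (#|E| < f0 s l #|V|)%N.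
Proof.
move=> uE y0 ys ye; rewrite ltnNge; apply/negP => leE.
exact: (no_matching_of_cover y0 ys ye) (f0P _ uE leE).
Qed.

(** By minimality of [f0], some hypergraph with at least [n] edges has no matching of size [s];
    duality covers it, its edges being nonempty as [l > 0]. *)
Lemma cover_of_lt_f0 s (l m n : nat) : 0 <= s -> (0 < l)%N -> (n < f0 s l m)%N ->
  exists (V : finType) (E : {set {set V}}) (y : V -> R),
    [/\ #|V| = m, uniform_hypergraph l E, (n <= #|E|)%N &
    [/\ forall v, 0 <= y v, \sum_v y v < s &
    forall e, e \in E -> 1 <= \sum_(v in e) y v]].
Proof.
move=> s0 l0 nf; apply: contrapT => H; move: nf; apply/negP; rewrite -leqNgt.
apply: f0_min => V E cV uE nE; apply: contrapT => nm; apply: H.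
have [e eE|y [y0 ys ye]] := cover_of_no_matching s0 _ nm.
  by rewrite -card_gt0 (uE _ eE).
by exists V, E, y.
Qed.

End F0.

(** * Finite i.i.d. samples *)

Section Uniform.
Variables (R : realType) (n : nat).
Local Open Scope ereal_scope.

Let inv_ge0 : (0 <= n.+1%:R^-1 :> R)%R. Proof. by rewrite invr_ge0. Qed.

(** The uniform law on the first [n.+1] naturals. Every subset of [nat] is measurable, so finite
    sample spaces enumerated in [nat] raise no measurability question. *)
Definition unif : set nat -> \bar R :=
  mscale (NngNum inv_ge0) (msum (fun k => \d_k) n.+1).
HB.instance Definition _ := Measure.on unif.

Lemma unifE (A : set nat) :
  unif A = (n.+1%:R^-1 * \sum_(k < n.+1) (nat_of_ord k \in A)%:R)%:E.
Proof.
rewrite /unif /mscale /msum /= EFinM; congr (_ * _).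
by rewrite -sumEFin; apply: eq_bigr => k _; exact: diracE.
Qed.

Lemma unif_setT : unif setT = 1.
Proof.
rewrite unifE; under eq_bigr do rewrite in_setT.
by rewrite sumr_const card_ord -[(1 *+ _)%R]/(n.+1%:R) mulVf.
Qed.
HB.instance Definition _ := Measure_isProbability.Build _ _ _ unif unif_setT.

Lemma expectation_unif (X : nat -> R) : (forall k, 0 <= X k)%R ->
  'E_unif[X] = (n.+1%:R^-1 * \sum_(k < n.+1) X k)%:E.
Proof.
move=> X0; rewrite unlock /unif.
have mX : measurable_fun [set: nat] (EFin \o X) by [].
rewrite ge0_integral_mscale//=; last by move=> k _; rewrite lee_fin.
rewrite ge0_integral_measure_sum//=; last by move=> k _; rewrite lee_fin.
rewrite EFinM -sumEFin; congr (_ * _); apply: eq_bigr => k _.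
by rewrite integral_dirac// diracT mul1e.
Qed.

End Uniform.

Lemma sum_nth_enum (R : nmodType) (F : finType) (x0 : F) (G : F -> R) :
  \sum_(k < #|F|) G (nth x0 (enum F) k) = \sum_x G x.
Proof. by rewrite -[RHS]big_enum (big_nth x0) -cardE big_mkord. Qed.

Section IIDSample.
Variables (R : realType) (W : finType) (w0 : W) (l n : nat).
Hypothesis cardF : #|{ffun 'I_l -> W}| = n.+1.
Variable y : W -> R.
Hypothesis y_ge0 : forall w, 0 <= y w.

Let F := {ffun 'I_l -> W}.
Let f_ (k : nat) : F := nth [ffun=> w0] (enum F) k.

Lemma unif_pred (B : pred F) : unif R n [set k | B (f_ k)]%classic =
  (n.+1%:R^-1 * #|B|%:R)%:E.
Proof.
rewrite unifE; congr (_ * _)%:E; rewrite -sum1_card natr_sum.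
transitivity (\sum_(k < #|F|) (B (f_ k))%:R : R).
  rewrite cardF; apply: eq_bigr => k _; congr (nat_of_bool _)%:R.
  by apply/idP/idP; rewrite inE.
rewrite (sum_nth_enum _ (fun f => (B f)%:R)) big_mkcond/=.
by rewrite [RHS]big_mkcond/=; apply: eq_bigr => f _; rewrite unfold_in; case: (B f).
Qed.

Let cardFE : n.+1%:R = \prod_(i < l) #|W|%:R :> R.
Proof. by rewrite -cardF card_ffun card_ord prodr_const card_ord natrX. Qed.

(** Counting a product set gives a product of proportions; marginals and independence are both
    instances. *)
Let unif_family (B : 'I_l -> pred W) :
  unif R n [set k | [forall i, B i (f_ k i)]]%classic =
  (\prod_(i < l) (#|B i|%:R / #|W|%:R))%:E.
Proof.
rewrite (unif_pred (fun f => [forall i, B i (f i)])).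
rewrite prodf_div -cardFE mulrC; congr (_ / _)%:E.
rewrite -natr_prod; congr _%:R.
have -> : (\prod_(i < l) #|B i| = #|family (fun i => B i)|)%N.
  by rewrite card_family foldrE big_image.
by [].
Qed.

Definition iid_sample (i : 'I_l) (k : nat) : R := y (f_ k i).
HB.instance Definition _ i :=
  isMeasurableFun.Build _ _ _ _ (iid_sample i) (fun _ _ _ => I).

Let W_neq0 : #|W|%:R != 0 :> R.
Proof. by rewrite pnatr_eq0 -lt0n; apply/card_gt0P; exists w0. Qed.

Let unif_marginal i (A : set R) : unif R n (iid_sample i @^-1` A)%classic =
  (#|[pred w | `[< A (y w) >]]|%:R / #|W|%:R)%:E.
Proof.
rewrite (_ : (iid_sample i @^-1` A)%classic =
    [set k | [forall j,
      (if j == i then fun w => `[< A (y w) >] else xpredT) (f_ k j)]]%classic).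
  rewrite (unif_family (fun j => if j == i then fun w => `[< A (y w) >] else xpredT)).
  rewrite (bigD1 i)//= eqxx big1 ?mulr1// => j /negbTE ->.
  by rewrite divff.
apply/seteqP; split=> k /=.
  by move=> Ak; apply/fintype.forallP => j; case: eqP => // ->; apply/asboolP.
by move/fintype.forallP/(_ i); rewrite eqxx => /asboolP.
Qed.

Lemma iid_sampleP : \sum_w y w = #|W|%:R ->
  nonneg_iid_mean1 (P := unif R n) (fun i => iid_sample i : {RV unif R n >-> R}).
Proof.
move=> ysum; split=> //.
- move=> i k; exact: y_ge0.
- move=> J A mA.
  (* Coordinates outside [J] are left free, which makes the event a product over all coordinates. *)
  rewrite (_ : (\bigcap_(i in _) _)%classic =
      [set k | [forall i, (fun w => (i \in J) ==> `[< A i (y w) >]) (f_ k i)]]%classic).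
    etransitivity; first exact: (unif_family (fun i w => (i \in J) ==> `[< A i (y w) >])).
    rewrite [in RHS]big_mkcond/= -prodEFin; apply: eq_bigr => i _.
    case: ifPn => iJ; first by rewrite (unif_marginal i (A i)).
    by rewrite divff.
  apply/seteqP; split=> k /=.
    move=> h; apply/fintype.forallP => i; apply/implyP => iJ; apply/asboolP; exact: h.
  by move=> /fintype.forallP h i /= iJ; move: (h i); rewrite iJ => /asboolP.
- by move=> i j A mA;
  rewrite /distribution /pushforward/= (unif_marginal i) (unif_marginal j).
- move=> i; rewrite expectation_unif; last by move=> k; exact: y_ge0.
  have -> : \sum_(k < n.+1) iid_sample i k = \sum_(f : F) y (f i).
    by rewrite -cardF; apply: (sum_nth_enum [ffun=> w0] (fun f : F => y (f i))).
  congr _%:E.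
  (* With factors 1 away from [i], the sum over tuples factors into a product of averages. *)
  pose g (j : 'I_l) w := if j == i then y w else 1.
  transitivity (\prod_j ((\sum_w g j w) / #|W|%:R)).
    rewrite prodf_div -cardFE mulrC bigA_distr_bigA/=; congr (_ / _).
    apply: eq_bigr => f _; rewrite (bigD1 i)//= /g eqxx big1 ?mulr1// => j.
    by move/negbTE ->.
  rewrite big1// => j _; rewrite /g; case: eqP => _; first by rewrite ysum divff.
  by rewrite sumr_const -[1 *+ _]/(#|W|%:R) divff.
Qed.

End IIDSample.

Lemma Theta_ge_count (R : realType) (l : nat) (d : R) (W : finType) (y : W -> R) :
  (forall w, 0 <= y w) -> \sum_w y w = #|W|%:R -> (0 < #|W|)%N ->
  ((#|[pred f : {ffun 'I_l -> W} | l%:R + d <= \sum_i y (f i)]|%:R / (#|W| ^ l)%:R)%:E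
     <= Theta l d)%E.
Proof.
move=> y0 ys /card_gt0P[w0 _].
have [n cF] : exists n, #|{ffun 'I_l -> W}| = n.+1.
  exists #|{ffun 'I_l -> W}|.-1; rewrite prednK//.
  by apply/card_gt0P; exists [ffun=> w0].
apply: ereal_sup_ubound => /=.
exists _, nat, (unif R n), (fun i => iid_sample w0 y i : {RV unif R n >-> R}).
split; first exact: (iid_sampleP w0 cF).
have := unif_pred R w0 cF [pred f : {ffun 'I_l -> W} | l%:R + d <= \sum_i y (f i)].
rewrite -cF card_ffun card_ord mulrC => <-.
by [].
Qed.

Lemma Theta_ge_lt_f0 (R : realType) (l d m n : nat) : (0 < l)%N -> (0 < d)%N ->
  (n < f0 ((m + d)%:R / (l + d)%:R : R) l m)%N ->
  (((l`! * n)%:R / ((m + d) ^ l)%:R)%:E <= Theta l (d%:R : R))%E.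
Proof.
move=> l0 d0 nf.
have ld0 : 0 < (l + d)%:R :> R by rewrite ltr0n; lia.
have md0 : 0 < (m + d)%:R :> R by rewrite ltr0n; lia.
have s0 : 0 <= (m + d)%:R / (l + d)%:R :> R by rewrite divr_ge0.
have [V [E [y [cV uE nE [y0 ys ye]]]]] := cover_of_lt_f0 s0 l0 nf.
(* The nonnegative constant that raises the mean to exactly 1. *)
pose c : R := 1 - (l + d)%:R * (\sum_v y v) / (m + d)%:R.
have c0 : 0 <= c.
  by rewrite subr_ge0 ler_pdivrMr// mul1r mulrC -ler_pdivlMr// ltW.
(* The [d] padding vertices carry only the constant. They bring the number of vertices to [m + d],
   which exceeds the total of [(l + d) * y]. *)
pose z (w : V + 'I_d) : R :=
  match w with inl v => (l + d)%:R * y v + c | inr _ => c end.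
have cW : #|{: V + 'I_d}| = (m + d)%N by rewrite card_sum cV card_ord.
have := @Theta_ge_count R l d%:R _ z; rewrite cW; move=> H.
apply: le_trans (H _ _ _) => {H}; last 3 first.
- by case=> [v|i] //=; rewrite addr_ge0// mulr_ge0// ltW.
- rewrite big_sumType/= big_split/= -mulr_sumr !sumr_const cV card_ord -addrA.
  rewrite -mulrnDr -[c *+ _]mulr_natr /c mulrBl mul1r.
  by rewrite mulfVK ?gt_eqF// addrC subrK.
- by lia.
rewrite lee_fin ler_pM2r ?invr_gt0 ?ltr0n ?expn_gt0 ?addn_gt0 ?d0 ?orbT//.
rewrite ler_nat; apply: (@leq_trans (l`! * #|E|)); first by rewrite leq_mul2l nE orbT.
rewrite -(card_inj_image uE).
pose h (f : {ffun 'I_l -> V}) : {ffun 'I_l -> V + 'I_d} := [ffun i => inl (f i)].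
have hinj : injective h.
  by move=> f g /ffunP fg; apply/ffunP => i; have := fg i; rewrite !ffunE => -[].
rewrite -(card_imset _ hinj); apply: subset_leq_card; apply/fintype.subsetP => g /imsetP[f].
rewrite inE => /andP[fi fE] ->{g}; rewrite inE.
have := ye _ fE; rewrite (sum_inj_image y fi) => yf.
under eq_bigr do rewrite ffunE /=.
rewrite big_split/= -mulr_sumr sumr_const card_ord.
have : 0 <= c *+ l by rewrite mulrn_wge0.
have : (l + d)%:R <= (l + d)%:R * \sum_i y (f i) by rewrite ler_peMr// ltW.
by rewrite [in X in X <= _ -> _]natrD; lra.
Qed.

(** * Discretization by quantiles *)

Section Quantile.
Context (R : realType) (d : measure_display) (T : measurableType d).
Variables (P : probability T R) (X : {RV P >-> R}).
Local Open Scope classical_set_scope.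

(** The generalized inverse of the cdf, meaningful for [0 < u < 1], where the set is nonempty and,
    for nonnegative [X], bounded below. *)
Definition quantile (u : R) : R := inf [set x | (u%:E <= cdf X x)%E].

Hypothesis X_ge0 : forall w, 0 <= X w.

Lemma quantile_lb (u x : R) : 0 < u -> (u%:E <= cdf X x)%E -> 0 <= x.
Proof.
move=> u0 ux; rewrite leNgt; apply/negP => x0; move: ux; apply/negP; rewrite -ltNge.
rewrite (_ : cdf X x = 0%E) ?lte_fin//.
rewrite /cdf /distribution /pushforward (_ : _ @^-1` _ = set0) ?measure0//.
by apply/seteqP; split=> // w /=; rewrite in_itv/= => Xx; have := X_ge0 w; lra.
Qed.

Lemma has_inf_quantile (u : R) : 0 < u < 1 -> has_inf [set x | (u%:E <= cdf X x)%E].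
Proof.
move=> /andP[u0 u1]; split; last by exists 0 => x /=; exact: quantile_lb.
have : \forall x \near +oo%R, (u%:E < cdf X x)%E.
  have u1' : (u%:E < 1)%E by rewrite lte_fin.
  exact: ((@cvg_cdfy1 _ _ _ P X) _ (open_ereal_gt' u1')).
move=> h; have [x /= ux] := filter_ex h; exists x; exact: ltW.
Qed.

Lemma quantile_ge0 (u : R) : 0 < u < 1 -> 0 <= quantile u.
Proof.
move=> u01; apply: lb_le_inf; first by have [] := has_inf_quantile u01.
by move=> x /=; apply: quantile_lb; case/andP: u01.
Qed.

Lemma le_quantile (u v : R) : 0 < u -> u <= v -> v < 1 -> quantile u <= quantile v.
Proof.
move=> u0 uv v1; have v0 := lt_le_trans u0 uv.
have [nv _] := has_inf_quantile (introT andP (conj v0 v1)).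
apply: lb_le_inf => // x /= vx; apply: ge_inf.
  by exists 0 => z /=; exact: quantile_lb.
by apply: le_trans vx; rewrite lee_fin.
Qed.

(** Right continuity of the cdf makes the infimum attained. *)
Lemma cdf_quantile (u : R) : 0 < u < 1 -> (u%:E <= cdf X (quantile u))%E.
Proof.
move=> u01; have hi := has_inf_quantile u01.
have h := @cdf_right_continuous _ _ _ _ X (quantile u).
rewrite -(cvg_lim _ h)//; apply: lime_ge; first by apply/cvg_ex; eexists; exact: h.
near=> x.
have qx : quantile u < x by near: x; exact: nbhs_right_gt.
have xq : 0 < x - quantile u by rewrite subr_gt0.
have [z /= uz zx] := inf_adherent xq hi.
apply: le_trans uz _; apply: cdf_nondecreasing; apply: ltW.
by move: zx; rewrite -/(quantile u) addrC subrK.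
Unshelve. all: by end_near. Qed.

(** The open half-line is an increasing union of closed ones ending before the infimum, where the
    cdf is still below [u]. *)
Lemma lt_quantile (u : R) : 0 < u < 1 -> (P (X @^-1` `]-oo, quantile u[) <= u%:E)%E.
Proof.
move=> u01; have hi := has_inf_quantile u01.
pose F k := X @^-1` `]-oo, quantile u - k.+1%:R^-1].
have -> : X @^-1` `]-oo, quantile u[ = \bigcup_k F k.
  apply/seteqP; split=> [w /= /[!in_itv]/= /ltr_add_invr[k wk]|w [k _]/=].
    by exists k => //; rewrite /F/= in_itv/= lerBrDr ltW.
  rewrite /F/= !in_itv/= => /le_lt_trans; apply.
  by rewrite ltrBlDr ltrDl invr_gt0 ltr0n.
have cF : P (F k) @[k --> \oo] --> P (\bigcup_k F k).
  apply: nondecreasing_cvg_mu => [k||k j kj].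
  - exact: measurable_funPTI.
  - by apply: bigcup_measurable => k _; exact: measurable_funPTI.
  - apply/subsetPset; apply: preimage_subset; apply: subset_itvl.
    by rewrite bnd_simp lerD2l lerN2 lef_pV2 ?posrE// ler_nat.
rewrite -(cvg_lim _ cF)//; apply: lime_le; first by apply/cvg_ex; eexists; exact: cF.
near=> k; rewrite leNgt; apply/negP => uF.
have : quantile u <= quantile u - k.+1%:R^-1.
  apply: ge_inf; last exact: ltW.
  by exists 0 => z /=; apply: quantile_lb; case/andP: u01.
by rewrite leNgt ltrBlDr ltrDl invr_gt0 ltr0n.
Unshelve. all: by end_near. Qed.

End Quantile.

(* [c] is a cumulative distribution on 'I_m dominated by the uniform one; the
   weights kappa a b are the interval overlaps |[c a, c (a+1)] /\ [b/m, (b+1)/m]|,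
   a coupling of the two laws that is supported on a <= b. *)
Lemma upset_weight_le (R : realFieldType) (l m : nat) (c : nat -> R)
    (A : {pred {ffun 'I_l -> 'I_m}}) :
  (0 < m)%N -> c 0%N = 0 -> c m = 1 ->
  (forall a, (a < m)%N -> c a <= c a.+1) ->
  (forall a, (a <= m)%N -> a%:R / m%:R <= c a) ->
  (forall f g : {ffun 'I_l -> 'I_m}, (forall i, f i <= g i)%N -> f \in A -> g \in A) ->
  \sum_(f in A) \prod_i (c (f i).+1 - c (f i)) <= #|A|%:R / (m ^ l)%:R.
Proof.
move=> m0 c0 cm cnd cge Aup.
have mR : 0 < m%:R :> R by rewrite ltr0n.
have c01 a : (a <= m)%N -> 0 <= c a <= 1.
  move=> am; apply/andP; split; first by apply: le_trans (cge a am); rewrite divr_ge0.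
  rewrite -cm; move: {2}(m - a)%N (erefl (m - a)%N) => k.
  elim: k a am => [|k IH] a am mak; first by have -> : a = m by lia.
  by apply: (le_trans (cnd a _)); [lia|apply: IH; lia].
pose u (b : nat) : R := b%:R / m%:R.
have u_le b b' : (b <= b')%N -> u b <= u b'.
  by move=> bb; rewrite /u ler_pM2r ?invr_gt0// ler_nat.
(* This is the length of the intersection of [0, c a] and [0, u b]; the overlap is its mixed second
   difference, so row and column sums telescope. *)
pose G a b := Order.min (c a) (u b).
pose kappa (a b : nat) := (G a.+1 b.+1 - G a b.+1) - (G a.+1 b - G a b).
have k_ge0 (a b : 'I_m) : 0 <= kappa a b.
  have ? := cnd a (ltn_ord a); have ? := u_le b b.+1 (leqnSn b).
  rewrite /kappa /G; case: (leP (c a.+1) (u b.+1)); case: (leP (c a) (u b.+1));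
    by case: (leP (c a.+1) (u b)); case: (leP (c a) (u b)) => ? ? ? ?; lra.
(* The block of [b] ends at or before [u a <= c a], where the interval of [a] starts. *)
have k_0 (a b : 'I_m) : (b < a)%N -> kappa a b = 0.
  move=> ba; have ? := cnd a (ltn_ord a); have ? := u_le b b.+1 (leqnSn b).
  have := cge a (ltnW (ltn_ord a)); rewrite -/(u a); have := u_le _ _ ba => ? ?.
  by rewrite /kappa /G !min_r; lra.
have k_row (a : 'I_m) : \sum_(b < m) kappa a b = c a.+1 - c a.
  have /andP[ca0 ca1] := c01 a (ltnW (ltn_ord a)).
  have /andP[cb0 cb1] := c01 a.+1 (ltn_ord a).
  rewrite -(big_mkord xpredT (fun b => kappa a b)) /kappa.
  rewrite (telescope_sumr (fun b => G a.+1 b - G a b))//.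
  rewrite /G /u mul0r divff ?gt_eqF// (min_l ca1) (min_l cb1) (min_r ca0) (min_r cb0).
  by rewrite subrr subr0.
have k_col (b : 'I_m) : \sum_(a < m) kappa a b = m%:R^-1.
  transitivity (\sum_(a < m) ((G a.+1 b.+1 - G a.+1 b) - (G a b.+1 - G a b))).
    by apply: eq_bigr => a _; rewrite /kappa; ring.
  rewrite -(big_mkord xpredT (fun a => (G a.+1 b.+1 - G a.+1 b) - (G a b.+1 - G a b))).
  rewrite (telescope_sumr (fun a => G a b.+1 - G a b))//.
  have u0 k : 0 <= u k by rewrite divr_ge0.
  have u1 k : (k <= m)%N -> u k <= 1 by move=> km; rewrite ler_pdivrMr// mul1r ler_nat.
  rewrite /G c0 cm !(min_l (u0 _)) !min_r ?u1//; last exact: ltnW.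
  by rewrite /u -[b.+1]addn1 natrD; field; rewrite gt_eqF.
under eq_bigr do under eq_bigr do rewrite -k_row.
under eq_bigr do rewrite bigA_distr_bigA/=.
(* A nonzero product of overlaps needs [f <= g] pointwise, so for [f] in [A] only the [g] in [A]
   contribute. *)
apply: (@le_trans _ _ (\sum_(f in A) \sum_(g : {ffun 'I_l -> 'I_m} | g \in A)
    \prod_i kappa (f i) (g i))).
  apply: ler_sum => f fA; rewrite [leRHS]big_mkcond/=; apply: ler_sum => g _.
  case: ifPn => // gA.
  have [/fintype.forallP fg|/forallPn[i]] := boolP [forall i, (f i <= g i)%N].
    by rewrite (Aup f g) in gA.
  by rewrite -ltnNge => gf; rewrite (bigD1 i)//= k_0// mul0r.
(* Releasing [f] adds nonnegative terms only; afterwards the column sums apply to each [g]. *)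
apply: (@le_trans _ _ (\sum_(f : {ffun 'I_l -> 'I_m})
    \sum_(g : {ffun 'I_l -> 'I_m} | g \in A) \prod_i kappa (f i) (g i))).
  rewrite [leLHS]big_mkcond/=; apply: ler_sum => f _; case: ifP => // _.
  by apply: sumr_ge0 => g _; apply: prodr_ge0 => i _; exact: k_ge0.
rewrite exchange_big/=.
under eq_bigr => g _.
  rewrite -(bigA_distr_bigA (fun (i : 'I_l) (a : 'I_m) => kappa a (g i))).
  under eq_bigr do rewrite k_col.
  rewrite prodr_const card_ord; over.
by rewrite sumr_const -[_ *+ _]mulr_natl natrX exprVn.
Qed.

(** * Quantile sums and the mean *)

Section Mean.
Context (R : realType) (disp : measure_display) (T : measurableType disp).
Variables (P : probability T R) (X : {RV P >-> R}).
Hypothesis X_ge0 : forall w, 0 <= X w.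
Local Open Scope classical_set_scope.

(* Integrating the lower staircase of X with steps at the levels z j. *)
Lemma staircase_le_mean (z : nat -> R) (n : nat) :
  z 0%N = 0 -> (forall j, (j < n)%N -> z j <= z j.+1) ->
  (\sum_(j < n) (z j.+1 - z j)%:E * P (X @^-1` `[z j.+1, +oo[) <= 'E_P[X])%E.
Proof.
move=> z0 znd.
pose S (w : T) : R := \sum_(j < n) (z j.+1 - z j) * \1_(X @^-1` `[z j.+1, +oo[) w.
have mS j : measurable (X @^-1` `[z j.+1, +oo[) by exact: measurable_funPTI.
have step j (jn : (j < n)%N) w : 0 <= (z j.+1 - z j) * \1_(X @^-1` `[z j.+1, +oo[) w.
  by rewrite mulr_ge0// subr_ge0 znd.
have S_le w : S w <= X w.
  (* The second bound carries the induction: when [X w] reaches the next level, the sum so far is at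
     most the previous level. *)
  suff : S w <= X w /\ S w <= z n by case.
  rewrite /S; elim: n znd {S step} => [|k IH] znd.
    by rewrite big_ord0 z0; split.
  rewrite big_ord_recr/= indicE; have [|h1 h2] := IH.
    by move=> j jk; apply: znd; lia.
  have zk := znd k (ltnSn k).
  case: (boolP (w \in _)) => [/set_mem/=|_].
    by rewrite in_itv/= andbT mulr1 => zX; split; lra.
  by rewrite mulr0 addr0; split=> //; lra.
rewrite expectation_def; apply: (@le_trans _ _ (\int[P]_w (S w)%:E)%E).
  rewrite /S; under eq_integral do rewrite -sumEFin.
  rewrite ge0_integral_sum//=.
  - apply: lee_sum => j _; under eq_integral do rewrite EFinM.
    rewrite ge0_integralZl//=.
    + by rewrite integral_indic// setIT.
    + by apply/measurable_EFinP; exact: measurable_indic.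
    + by rewrite lee_fin subr_ge0 znd.
  - by move=> j; apply/measurable_EFinP; apply: measurable_funM => //; exact: measurable_indic.
  - by move=> j w _; rewrite lee_fin step.
apply: ge0_le_integral => //=.
- by move=> w _; rewrite lee_fin sumr_ge0// => j _; exact: step.
- apply/measurable_EFinP; apply: measurable_sum => j; apply: measurable_funM => //.
- exact/measurable_EFinP.
- by move=> w _; rewrite lee_fin.
Qed.

(** The staircase with steps at the quantiles has tails at least [1 - u j]; Abel summation turns
    these into equal weights [1 / n.+1] on the quantiles. *)
Lemma sum_quantile_le (n : nat) : ('E_P[X] = 1)%E ->
  \sum_(j < n) quantile X (j.+1%:R / n.+1%:R) <= n.+1%:R.
Proof.
move=> EX.
pose u (j : nat) : R := j.+1%:R / n.+1%:R.
have n0 : 0 < n.+1%:R :> R by rewrite ltr0n.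
have u01 j : (j < n)%N -> 0 < u j < 1.
  by move=> jn; rewrite divr_gt0//= ltr_pdivrMr// mul1r ltr_nat.
(* Level 0 is prepended to the quantiles, hence the index shift between [z] and [u]. *)
pose z (j : nat) := if j is j'.+1 then quantile X (u j') else 0.
have znd j : (j < n)%N -> z j <= z j.+1.
  case: j => [|j] jn /=; first by apply: quantile_ge0 => //; exact: u01.
  have /andP[? _] := u01 j (ltnW jn); have /andP[_ ?] := u01 _ jn.
  by apply: le_quantile => //; rewrite /u ler_pM2r ?invr_gt0// ler_nat.
have := @staircase_le_mean z n erefl znd; rewrite EX => h.
have {h} : \sum_(j < n) (z j.+1 - z j) * (1 - u j) <= 1.
  rewrite -lee_fin -sumEFin; apply: le_trans h; apply: lee_sum => j _.
  rewrite EFinM; apply: lee_wpmul2l; first by rewrite lee_fin subr_ge0 znd.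
  have -> : X @^-1` `[z j.+1, +oo[ = ~` (X @^-1` `]-oo, z j.+1[).
    by rewrite preimage_setC setCitvl.
  rewrite probability_setC; last exact: measurable_funPTI.
  by rewrite EFinB; apply: leeB => //; apply: lt_quantile => //; exact: u01.
suff -> : \sum_(j < n) (z j.+1 - z j) * (1 - u j) =
    (\sum_(j < n) quantile X (u j)) / n.+1%:R by rewrite ler_pdivrMr// mul1r.
(* The boundary term vanishes at [k = n]. *)
have abel k : (k <= n)%N -> \sum_(j < k) (z j.+1 - z j) * (1 - u j) =
    (\sum_(j < k) quantile X (u j)) / n.+1%:R + (n - k)%:R / n.+1%:R * z k.
  elim: k => [|k IH] kn; first by rewrite !big_ord0 mul0r mulr0 addr0.
  rewrite !big_ord_recr/= IH; last exact: ltnW.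
  have -> : (n - k)%:R = (n - k.+1)%:R + 1 :> R by rewrite natr1; congr _%:R; lia.
  have -> : u k = 1 - ((n - k.+1)%:R + 1) / n.+1%:R.
    rewrite /u natrB// -[n.+1]addn1 natrD; field.
    by rewrite -natr1 in n0; rewrite gt_eqF.
  by field; rewrite gt_eqF.
by rewrite abel// subnn mul0r mul0r addr0.
Qed.

End Mean.

Lemma measure_bigsetU_le (R : realType) (disp : measure_display)
    (T : measurableType disp) (mu : {measure set T -> \bar R}) (I : Type) (s : seq I)
    (Q : pred I) (E : I -> set T) :
  (forall i, measurable (E i)) ->
  (mu (\big[setU/set0]_(i <- s | Q i) E i) <= \sum_(i <- s | Q i) mu (E i))%E.
Proof.
move=> mE; elim: s => [|i s IH]; first by rewrite !big_nil measure0.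
rewrite !big_cons; case: ifP => // _.
apply: (@le_trans _ _ (mu (E i) + mu (\big[setU/set0]_(j <- s | Q j) E j))%E).
  by apply: measureU2 => //; exact: bigsetU_measurable.
exact: leeD2l.
Qed.

(** * From tail probabilities to counting tuples *)

Section Discretization.
Context (R : realType) (disp : measure_display) (T : measurableType disp).
Variables (P : probability T R) (l : nat) (X : 'I_l -> {RV P >-> R}).
Hypothesis iidX : nonneg_iid_mean1 X.
Local Open Scope classical_set_scope.

(** The levels [y] cut the line into [n.+1] cells, the last one unbounded, so that [ord_max] counts
    as passing any threshold. Rounding each variable up within its cell puts the event into cells
    indexed by an up-closed set, whose weight is at most its uniform weight. *)
Lemma tail_le_upset (y : nat -> R) (i0 : 'I_l) (n : nat) (t : R) :
  (forall j k, (j <= k < n)%N -> y j <= y k) ->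
  (forall j, (j < n)%N -> ((j.+1%:R / n.+1%:R)%:E <= cdf (X i0) (y j))%E) ->
  (P [set w | (t <= \sum_(i < l) X i w)%R] <=
    (#|[pred f : {ffun 'I_l -> 'I_n.+1} |
        [exists i, f i == ord_max] || (t <= \sum_i y (f i))]|%:R / (n.+1 ^ l)%:R)%:E)%E.
Proof.
set A := [pred f | _]; move=> ynd ycdf; have [X0 indX idX _] := iidX.
(* The union of the first [a] cells: empty at 0 and the whole line from [n.+1] on. *)
pose D (a : nat) : set R :=
  if a is a'.+1 then if (a' < n)%N then `]-oo, y a'] else setT else set0.
have mD a : measurable (D a) by case: a => [|a] //=; case: ifP.
have DS a : (a < n.+1)%N -> D a `<=` D a.+1.
  case: a => [|a] an //=; case: (ltnP a.+1 n) => aS; last by [].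
  rewrite (ltnW aS); apply: subset_itvl; rewrite bnd_simp.
  by apply: ynd; rewrite leqnSn.
have mXD i a : measurable (X i @^-1` D a) by exact: measurable_funPTI.
pose c a := fine (P (X i0 @^-1` D a)).
have cE a : P (X i0 @^-1` D a) = (c a)%:E by rewrite fineK// fin_num_measure.
pose I a := D a.+1 `\` D a.
have mI a : measurable (I a) by exact: measurableD.
have PI i (a : 'I_n.+1) : P (X i @^-1` I a) = (c a.+1 - c a)%:E.
  have := idX i i0 (I a) (mI a); rewrite /distribution /pushforward => ->.
  rewrite (_ : _ @^-1` I a = (X i0 @^-1` D a.+1) `\` (X i0 @^-1` D a))// measureD//;
    last by rewrite -ge0_fin_numE// fin_num_measure.
  rewrite setIidr; last by apply: preimage_subset; exact: DS.
  by rewrite EFinB; congr (_ - _)%E; exact: cE.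
pose E (f : {ffun 'I_l -> 'I_n.+1}) : set T :=
  \bigcap_(i in [set` [set: 'I_l]%SET]) (X i @^-1` I (f i)).
have mE f : measurable (E f).
  apply: fin_bigcap_measurable; first exact: finite_finset.
  by move=> i _; exact: measurable_funPTI.
have PE f : P (E f) = (\prod_i (c (f i).+1 - c (f i)))%:E.
  rewrite /E (indX [set: 'I_l]%SET (fun i => I (f i)))//.
  rewrite (eq_bigr (fun i => (c (f i).+1 - c (f i))%:E)) => [|i _]; last exact: PI.
  by rewrite prodEFin; congr _%:E; apply: eq_bigl => i; rewrite finset.in_setT.
have sub : [set w | (t <= \sum_(i < l) X i w)%R] `<=` \big[setU/set0]_(f | f \in A) E f.
  move=> w /= tX.
  have ex i : exists a, X i w \in D a.+1.
    by exists n; rewrite /= ltnn inE.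
  (* The least such index names the cell that contains [X i w]. *)
  pose N i := ex_minn (ex i).
  have Nn i : (N i < n.+1)%N.
    rewrite /N; case: ex_minnP => a _; apply.
    by rewrite /= ltnn inE.
  rewrite -bigcup_seq_cond.
  exists [ffun i => Ordinal (Nn i)] => /=.
    rewrite mem_index_enum/= inE; apply/orP.
    set g := [ffun i => Ordinal (Nn i)].
    case: (boolP [exists i, g i == ord_max]) => [?|/existsPn nmax]; [by left|right].
    apply: (le_trans tX); apply: ler_sum => i _.
    have := nmax i; rewrite /g ffunE /= -val_eqE /= => Nin.
    have {}Nin : (N i < n)%N by have := Nn i; lia.
    move: Nin; rewrite /N; case: ex_minnP => a /set_mem /= + _ an.
    by rewrite an /= in_itv.
  move=> i _; rewrite /= ffunE /= /I /N; case: ex_minnP => a /set_mem Da amin.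
  split => // Da'; case: a Da amin Da' => [|a] // _ /(_ a) + /mem_set Da'.
  by move=> /(_ Da'); rewrite ltnn.
apply: (@le_trans _ _ (P (\big[setU/set0]_(f | f \in A) E f))).
  apply: le_measure; rewrite ?inE//; last exact: bigsetU_measurable.
  rewrite -[X in measurable X]setTI.
  have mS : measurable_fun setT (fun w => \sum_(i < l) X i w) by exact: measurable_sum.
  have -> : [set w | (t <= \sum_(i < l) X i w)%R] =
      (fun w => \sum_(i < l) X i w) @^-1` `[t, +oo[.
    by apply/seteqP; split=> w /=; rewrite in_itv/= andbT.
  exact: mS.
apply: (le_trans (measure_bigsetU_le _ _ _ mE)).
rewrite (eq_bigr (fun f : {ffun 'I_l -> 'I_n.+1} =>
  (\prod_i (c (f i).+1 - c (f i)))%:E)) => [|f _]; last exact: PE.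
rewrite sumEFin lee_fin; apply: upset_weight_le => //.
- by rewrite /c /= preimage_set0 measure0.
- by rewrite /c /= ltnn preimage_setT probability_setT.
- move=> a an; rewrite -lee_fin -!cE; apply: le_measure; rewrite ?inE//.
  by apply: preimage_subset; exact: DS.
- case=> [|a] an; first by rewrite mul0r /c /= preimage_set0 measure0.
  rewrite -lee_fin -cE /=; case: ifP => an'; first exact: ycdf.
  have -> : a = n by lia.
  by rewrite preimage_setT probability_setT divff// gt_eqF.
- move=> f g fg; rewrite !inE => /orP[/existsP[i /eqP fi]|tf].
    apply/orP; left; apply/existsP; exists i; rewrite -val_eqE /= eqn_leq.
    by have := fg i; rewrite fi /= => ->; rewrite -ltnS ltn_ord.
  case: (boolP [exists i, g i == ord_max]) => [//|/existsPn nmax /=].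
  apply: (le_trans tf); apply: ler_sum => i _; apply: ynd; rewrite fg/=.
  by have := nmax i; rewrite -val_eqE /= => ?; have := ltn_ord (g i); lia.
Qed.

End Discretization.

(** Exactly [n ^_ l] tuples avoid both repetitions and the last vertex. The good ones among them are
    orderings of edges of a hypergraph with a cheap cover, hence with fewer than [f0] edges. All
    other tuples are counted as good. *)
Lemma tail_le_f0 (R : realType) (disp : measure_display) (T : measurableType disp)
    (P : probability T R) (l d n : nat) (X : 'I_l -> {RV P >-> R}) :
  nonneg_iid_mean1 X -> (0 < l)%N -> (0 < d)%N ->
  (P [set w | (l%:R + d%:R <= \sum_(i < l) X i w)%R]%classic <=
   (((n.+1 ^ l)%:R - (n ^_ l)%:R +
     (l`! * f0 ((n.+1 + d)%:R / (l + d)%:R : R) l n.+1)%:R) / (n.+1 ^ l)%:R)%:E)%E.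
Proof.
move=> iidX l0 d0; have [X0 _ _ EX] := iidX.
pose i0 := Ordinal l0.
pose y (j : nat) := quantile (X i0) (j.+1%:R / n.+1%:R).
have n0 : 0 < n.+1%:R :> R by rewrite ltr0n.
have ld0 : 0 < (l + d)%:R :> R by rewrite ltr0n; lia.
have u01 j : (j < n)%N -> 0 < (j.+1%:R / n.+1%:R : R) < 1.
  by move=> jn; rewrite divr_gt0//= ltr_pdivrMr// mul1r ltr_nat.
have y0 j : (j < n)%N -> 0 <= y j.
  by move=> jn; apply: (quantile_ge0 (X0 i0)); exact: u01.
have ynd j k : (j <= k < n)%N -> y j <= y k.
  move=> /andP[jk kn]; have /andP[? _] := u01 j (leq_ltn_trans jk kn).
  have /andP[_ ?] := u01 k kn.
  by apply: (le_quantile (X0 i0)) => //; rewrite ler_pM2r ?invr_gt0// ler_nat.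
have ycdf j : (j < n)%N -> ((j.+1%:R / n.+1%:R)%:E <= cdf (X i0) (y j))%E.
  by move=> jn; apply: (cdf_quantile (X0 i0)); exact: u01.
have htail := tail_le_upset iidX (l%:R + d%:R) ynd ycdf; apply: (le_trans htail).
rewrite lee_fin ler_pM2r ?invr_gt0 ?ltr0n ?expn_gt0//.
set A := [pred f | _].
pose z (v : 'I_n.+1) : R := if v == ord_max then 0 else y v / (l + d)%:R.
have z0 v : 0 <= z v.
  rewrite /z; case: eqP => // /eqP; rewrite -val_eqE /= => vn.
  by rewrite divr_ge0 ?y0//; have := ltn_ord v; lia.
pose E := [set e : {set 'I_n.+1} | (#|e| == l) && (1 <= \sum_(v in e) z v)]%SET.
have uE : uniform_hypergraph l E by move=> e; rewrite inE => /andP[/eqP].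
have Ef0 : (#|E| < f0 ((n.+1 + d)%:R / (l + d)%:R : R) l n.+1)%N.
  rewrite -[in X in f0 _ _ X](card_ord n.+1); apply: (@lt_f0_of_cover _ _ _ _ _ z) => //.
    rewrite big_ord_recr/= /z eqxx addr0.
    apply: (@le_lt_trans _ _ (\sum_(j < n) y j / (l + d)%:R)).
      by apply: ler_sum => j _; rewrite -val_eqE /= ltn_eqF.
    (* The mean bounds the quantile sum by [n.+1]; strictness comes from [d > 0]. *)
    rewrite -mulr_suml ltr_pM2r ?invr_gt0//.
    by apply: (le_lt_trans (sum_quantile_le (X0 i0) n (EX i0))); rewrite ltr_nat; lia.
  by move=> e; rewrite inE => /andP[].
pose B := [pred f : {ffun 'I_l -> 'I_n.+1} | (f \in ffun_on (predC1 ord_max)) && injectiveb f].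
have cB : #|B| = (n ^_ l)%N.
  have := card_inj_ffuns_on 'I_l (predC1 (ord_max : 'I_n.+1)).
  by rewrite cardC1 !card_ord /= cardsE.
have AB : (#|[predI A & B]| <= l`! * #|E|)%N.
  rewrite -(card_inj_image uE); apply: subset_leq_card; apply/fintype.subsetP => f.
  rewrite !inE => /andP[Af /andP[/ffun_onP fmax fi]]; rewrite fi/=.
  rewrite (sum_inj_image z fi) card_imset; last exact/injectiveP.
  rewrite cardsT card_ord eqxx/=.
  case/orP: Af => [/existsP[i /eqP fmi]|].
    by have := fmax i; rewrite inE fmi eqxx.
  rewrite (_ : \sum_i z (f i) = (\sum_i y (f i)) / (l + d)%:R).
    by rewrite ler_pdivlMr// mul1r natrD.
  rewrite mulr_suml; apply: eq_bigr => i _; have := fmax i.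
  by rewrite inE /z => /negbTE ->.
have cA : (#|A| + n ^_ l <= n.+1 ^ l + l`! * #|E|)%N.
  rewrite -cB -cardUI leq_add//; apply: leq_trans (max_card _) _.
  by rewrite card_ffun !card_ord.
have : (#|A| + n ^_ l <= n.+1 ^ l + l`! * f0 ((n.+1 + d)%:R / (l + d)%:R : R) l n.+1)%N.
  by apply: (leq_trans cA); rewrite leq_add2l leq_mul2l (ltnW Ef0) orbT.
by rewrite -(ler_nat R) !natrD; lra.
Qed.

(** * Passage to the limit *)

Lemma ffact_le_exp (n k : nat) : (n ^_ k <= n ^ k)%N.
Proof.
rewrite ffact_prod -[X in (_ <= n ^ X)%N](card_ord k) -prod_nat_const.
by apply: leq_prod => i _; exact: leq_subr.
Qed.

Lemma exp_le_ffact (n k : nat) : ((n.+1 - k) ^ k <= n ^_ k)%N.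
Proof.
rewrite ffact_prod -[X in (_ ^ X <= _)%N](card_ord k) -prod_nat_const.
by apply: leq_prod => i _; have := ltn_ord i; lia.
Qed.

Lemma Theta_ge0 (R : realType) (l : nat) (d : R) : (0 <= Theta l d)%E.
Proof.
(* The one-point weighting, that is the constant variable 1, is a competitor. *)
apply: le_trans (@Theta_ge_count R l d unit (fun=> 1) _ _ _) => //.
  by rewrite sumr_const.
by rewrite card_unit.
Qed.

(** The discretization bound at [n = 0] is a real number independent of the variables. *)
Lemma Theta_fin_num (R : realType) (l d : nat) :
  (0 < l)%N -> (0 < d)%N -> Theta l (d%:R : R) \is a fin_num.
Proof.
move=> l0 d0; rewrite ge0_fin_numE ?Theta_ge0//.
apply: le_lt_trans (ltry _); apply: ge_ereal_sup => _ [disp [T [P [X [iidX ->]]]]].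
exact: (@tail_le_f0 _ _ _ _ _ d 0).
Qed.

Section Limit.
Local Open Scope classical_set_scope.
Local Open Scope ring_scope.

(** The two comparisons squeeze the quotient, so it has a genuine limit and not only a limit
    superior. *)
Lemma f_ratio_cvg (R : realType) (l d : nat) : (0 < l)%N -> (0 < d)%N ->
  ((f0 ((m + d)%:R / (l + d)%:R : R) l m)%:R / 'C(m, l)%:R : R) @[m --> \oo] -->
    fine (Theta l (d%:R : R)).
Proof.
move=> l0 d0; have th0 := fine_ge0 (Theta_ge0 l (d%:R : R)).
have TE := fineK (Theta_fin_num R l0 d0).
set th := fine _ in TE th0 *.
pose F m := f0 ((m + d)%:R / (l + d)%:R : R) l m.
have lower n : th * (n.+1 ^ l)%:R <= (n.+1 ^ l)%:R - (n ^_ l)%:R + (l`! * F n.+1)%:R.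
  rewrite -ler_pdivlMr ?ltr0n ?expn_gt0// -lee_fin TE.
  apply: ge_ereal_sup => _ [disp [T [P [X [iidX ->]]]]].
  exact: tail_le_f0.
(* Sampling applies to [F m - 1], the largest value below [f0]; the summand l! pays for the missing
   edge. *)
have upper m : (l`! * F m)%:R <= l`!%:R + th * ((m + d) ^ l)%:R.
  case E : (F m) => [|k]; first by rewrite muln0 addr_ge0// mulr_ge0.
  rewrite mulnS natrD lerD2l -ler_pdivrMr; last by rewrite ltr0n expn_gt0 addn_gt0 d0 orbT.
  by rewrite -lee_fin TE; apply: Theta_ge_lt_f0 => //; rewrite -/(F m) E.
pose h (m : nat) : R := m%:R^-1.
have h0 : h m @[m --> \oo] --> (0 : R).
  rewrite /h gtr0_cvgV0; first exact: cvgr_idn.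
  by near=> m; rewrite ltr0n; near: m; exact: nbhs_infty_gt.
have lin (b : R) : (1 + b * h m) ^+ l @[m --> \oo] --> (1 : R).
  have hb : 1 + b * h m @[m --> \oo] --> (1 : R).
    rewrite -[X in _ --> X]addr0 -[X in _ + X](mulr0 b).
    by apply: cvgD; [exact: cvg_cst|apply: cvgM; [exact: cvg_cst|exact: h0]].
  rewrite -[X in _ --> X](expr1n _ l).
  apply: (@continuous_cvg _ _ _ _ _ (fun m => 1 + b * h m) (fun x : R => x ^+ l) 1) => //.
  exact: exprn_continuous.
(* On the left, 1 - (1 - l/m)^l bounds the share of exceptional tuples. On the right, the factors
   account for the padding by [d] vertices and for the falling factorial. *)
apply: (@squeeze_cvgr _ _ _ _
  (fun m => th - 1 + (1 + - l%:R * h m) ^+ l)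
  (fun m => (l`!%:R * h m + th * (1 + d%:R * h m) ^+ l) / (1 + - l%:R * h m) ^+ l)).
- near=> m; rewrite -/(F m).
  have lm : (l < m)%N by near: m; exact: nbhs_infty_gt.
  have m0 : 0 < m%:R :> R by rewrite ltr0n; lia.
  have ml0 : 0 < (m ^ l)%:R :> R by rewrite ltr0n expn_gt0; lia.
  have -> : (F m)%:R / 'C(m, l)%:R = (l`! * F m)%:R / (m ^_ l)%:R :> R.
    rewrite -bin_ffact !natrM; field.
    by rewrite !pnatr_eq0 -!lt0n fact_gt0 bin_gt0 ltnW.
  have aE : (1 + - l%:R * h m) ^+ l = ((m - l) ^ l)%:R / (m ^ l)%:R.
    rewrite !natrX -expr_div_n natrB ?(ltnW lm)// /h; congr (_ ^+ _); field.
    by rewrite gt_eqF.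
  have bE : (1 + d%:R * h m) ^+ l = ((m + d) ^ l)%:R / (m ^ l)%:R.
    rewrite !natrX -expr_div_n natrD /h; congr (_ ^+ _); field.
    by rewrite gt_eqF.
  have ffle : (m ^_ l)%:R <= (m ^ l)%:R :> R by rewrite ler_nat ffact_le_exp.
  have leff : ((m - l) ^ l)%:R <= (m ^_ l)%:R :> R.
    rewrite ler_nat; apply: leq_trans (exp_le_ffact m l).
    by rewrite leq_exp2r//; lia.
  have ml'0 : 0 < ((m - l) ^ l)%:R :> R by rewrite ltr0n expn_gt0; lia.
  have ff0 : 0 < (m ^_ l)%:R :> R by exact: lt_le_trans leff.
  apply/andP; split.
    apply: (@le_trans _ _ ((l`! * F m)%:R / (m ^ l)%:R)); last first.
      by apply: ler_wpM2l => //; rewrite lef_pV2.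
    rewrite aE ler_pdivlMr// mulrDl divfK ?gt_eqF//.
    have mE : m.-1.+1 = m by rewrite prednK//; lia.
    have := lower m.-1; have := exp_le_ffact m.-1 l; rewrite mE -(ler_nat R).
    lra.
  apply: (@le_trans _ _ ((l`!%:R + th * ((m + d) ^ l)%:R) / ((m - l) ^ l)%:R)).
    by apply: ler_pM => //; rewrite lef_pV2.
  rewrite aE bE invf_div.
  have -> : (l`!%:R * h m + th * (((m + d) ^ l)%:R / (m ^ l)%:R)) *
        ((m ^ l)%:R / ((m - l) ^ l)%:R) =
      (l`!%:R * (h m * (m ^ l)%:R) + th * ((m + d) ^ l)%:R) / ((m - l) ^ l)%:R.
    by field; rewrite !gt_eqF.
  (* The constant l! is absorbed since [m ^ l] is at least [m], as [l >= 1]. *)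
  rewrite ler_pM2r ?invr_gt0// lerD2r ler_peMr// /h.
  by rewrite mulrC ler_pdivlMr// mul1r ler_nat -[leqLHS]expn1 leq_pexp2l//; lia.
- rewrite -[X in _ --> X](subrK 1); apply: cvgD; first exact: cvg_cst.
  exact: lin.
- rewrite -[X in _ --> X]divr1; apply: cvgM; last first.
    by apply: cvgV => //; exact: lin.
  rewrite -[X in _ --> X]add0r -[X in _ --> X + _](mulr0 l`!%:R) -[X in _ --> _ + X]mulr1.
  by apply: cvgD; apply: cvgM; [exact: cvg_cst|exact: h0|exact: cvg_cst|exact: lin].
Unshelve. all: by end_near. Qed.

Lemma f_limsupE (R : realType) (l d : nat) : (0 < l)%N -> (0 < d)%N ->
  f_limsup R l d = (fine (Theta l (d%:R : R)))%:E.
Proof.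
move=> l0 d0; apply: (cvg_limn_einf_sup _).2.
by apply: cvg_EFin; [near=> m|exact: f_ratio_cvg].
Unshelve. all: by end_near. Qed.

End Limit.

Theorem theorem1p14 (R : realType) (l d : nat) (hl : (1 <= l)%N) (hd : (1 <= d)%N) :
  f_limsup R l d = Theta l (d%:R : R).
Proof. by rewrite f_limsupE// fineK// Theta_fin_num. Qed.
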